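(* Let $(X,d)$ be a nonempty metric space whose distance set $D=d(X\times X)$ is finite, and suppose there exists $r\in D$ such that the threshold relation $R_r^X$ is connected over $X$ and separating over $X$. Suppose that $$(X,d)\cong\prod_{a\in A}P_a^{\kappa_a},$$ where $A$ is a finite set, the $P_a$ are pairwise nonisometric finite $\ell^\infty$-prime metric spaces, and every $\kappa_a$ is a nonzero cardinal. Assume that $X$ has cardinal multiplicity uniqueness. Then $(X,d)$ is isometric to its $\ell^\infty$-square $X\times_\infty X$ if and only if every $\kappa_a$ is infinite.
   Context: All metric spaces are nonempty, all isometries are bijective, $\cong$ means isometric. Products (finite or infinite) carry the supremum metric $d((x_i),(y_i))=\sup_i d_i(x_i,y_i)$ and are called metric spaces only when this is finite-valued; $P^\kappa$ is the product of $\kappa$ copies of $P$, and $\times_\infty$ is the binary product. A metric space $X$ is $\ell^\infty$-prime if $|X|>1$ and every isometry $X\cong Y\times_\infty Z$ forces $|Y|=1$ or $|Z|=1$. For $r\geq0$, $R_r^X(x,y)\iff d(x,y)\leq r$. $R_r^X$ is connected over $X$ if for all distinct $x,y\in X$ there is a finite sequence $x=x_0,\dots,x_n=y$ with $R_r^X(x_i,x_{i+1})$ for all $0\le i<n$; it is separating over $X$ if for all distinct $x,y\in X$ there is $z\in X$ such that exactly one of $R_r^X(z,x)$, $R_r^X(z,y)$ holds. $X$ has cardinal multiplicity uniqueness if: whenever $X\cong\prod_{a\in A}P_a^{\kappa_a}$ and $X\cong\prod_{b\in B}Q_b^{\lambda_b}$ with $A,B$ finite, the $P_a$ pairwise nonisometric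 and $\ell^\infty$-prime, the $Q_b$ pairwise nonisometric and $\ell^\infty$-prime, and all cardinals $\kappa_a,\lambda_b$ nonzero, there is a bijection $\sigma:A\to B$ with $P_a\cong Q_{\sigma(a)}$ and $\kappa_a=\lambda_{\sigma(a)}$ for every $a\in A$. *)

(* Defs.v *)
From HB Require Import structures.
From mathcomp Require Import all_boot all_order all_algebra.
From mathcomp Require Import all_classical all_reals.
From mathcomp Require Import ereal topology metric_structure.
Set Implicit Arguments.
Unset Strict Implicit.
Unset Printing Implicit Defensive.
Import Order.TTheory GRing.Theory Num.Theory.
Local Open Scope classical_set_scope.
Local Open Scope card_scope.
Local Open Scope ring_scope.

(* [X ×∞ Y] is the product type [X * Y] with the maximum distance. *)
Section binary_product.
Context {R : realType} {X Y : metricType R}.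
Let prod_mdist (p q : X * Y) : R :=
  Num.max (mdist p.1 q.1) (mdist p.2 q.2).

Let prod_mdist_ge0 p q : 0 <= prod_mdist p q.
Proof. by rewrite /prod_mdist le_max mdist_ge0. Qed.

Let prod_mdist_positivity p q : prod_mdist p q = 0 -> p = q.
Proof.
move=> pq0; have : prod_mdist p q <= 0 by rewrite pq0.
rewrite /prod_mdist ge_max => /andP[h1 h2].
rewrite [p]surjective_pairing [q]surjective_pairing; congr pair;
  by apply: mdist_positivity; apply/eqP; rewrite eq_le ?h1 ?h2 mdist_ge0.
Qed.

Let prod_ballEmdist p d : ball p d = [set q | prod_mdist p q < d].
Proof.
apply/seteqP; split=> q; rewrite /ball /= /prod_ball /prod_mdist gt_max !ballEmdist.
  by move=> [/= -> ->].
by move=> /andP[].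
Qed.

HB.instance Definition _ := PseudoMetric_isMetric.Build R (X * Y)%type
  prod_mdist_ge0 prod_mdist_positivity prod_ballEmdist.
End binary_product.

Section isometries.
Context {R : realType}.

Definition isometric (X Y : metricType R) : Prop :=
  exists2 f : X -> Y, bijective f & forall x y, mdist (f x) (f y) = mdist x y.

(* Supremum distance on a possibly infinite product.  It may be [+oo]; adjoining
   [0] gives distance [0], rather than [-oo], on an empty product. *)
Definition sup_dist (I : Type) (T : I -> Type)
    (d : forall i, T i -> T i -> \bar R) (x y : forall i, T i) : \bar R :=
  ereal_sup ([set 0%E] `|` range (fun i => d i (x i) (y i))).

(* A cardinal is represented by a type of that cardinality. *)
Definition power_dist (P : metricType R) (k : Type) : (k -> P) -> (k -> P) -> \bar R :=
  sup_dist (fun _ x y => (mdist x y)%:E).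

(* The equation on distances forces the supremum distance on the product to be
   finite-valued, i.e. the product to be a metric space. *)
Definition isometric_prod_powers (X : metricType R) (A : Type)
    (P : A -> metricType R) (k : A -> Type) : Prop :=
  exists2 f : X -> forall a, k a -> P a, bijective f &
    forall x y, sup_dist (fun a => @power_dist (P a) (k a)) (f x) (f y) = (mdist x y)%:E.

(* Nonemptiness of [Y] and [Z] is automatic, as [X] is nonempty. *)
Definition linf_prime (X : metricType R) : Prop :=
  (exists x y : X, x <> y) /\
  forall Y Z : metricType R, isometric X (Y * Z)%type ->
    (exists y, [set: Y] = [set y]) \/ (exists z, [set: Z] = [set z]).

Definition prime_power_decomposition (X : metricType R) (A : finType)
    (P : A -> metricType R) (k : A -> Type) : Prop :=
  [/\ isometric_prod_powers X P k,
      forall a b, a <> b -> ~ isometric (P a) (P b),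
      forall a, linf_prime (P a)
    & forall a, [set: k a] !=set0].

Definition cardinal_multiplicity_uniqueness (X : metricType R) : Prop :=
  forall (A B : finType) (P : A -> metricType R) (Q : B -> metricType R)
    (k : A -> Type) (l : B -> Type),
  prime_power_decomposition X P k -> prime_power_decomposition X Q l ->
  exists2 s : A -> B, bijective s &
    forall a, isometric (P a) (Q (s a)) /\ [set: k a] #= [set: l (s a)].

Definition distance_set (X : metricType R) : set R :=
  range (fun p : X * X => mdist p.1 p.2).

Definition threshold (X : metricType R) (r : R) : rel X :=
  fun x y => mdist x y <= r.

Definition rel_connected (X : metricType R) (e : rel X) : Prop :=
  forall x y : X, x <> y -> exists2 s, path e x s & last x s = y.

Definition rel_separating (X : metricType R) (e : rel X) : Prop :=
  forall x y : X, x <> y -> exists z, e z x != e z y.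

End isometries.
Arguments threshold {R} X r.

(* Main.v *)
Require Import Defs.
From mathcomp Require Import all_boot all_order all_algebra.
From mathcomp Require Import all_classical all_reals.
From mathcomp Require Import ereal topology metric_structure.

(** Squaring a product of powers doubles the exponents: if [X] is the product of
    the [P a ^ k a], then [X * X] is the product of the [P a ^ (k a + k a)], because
    the maximum of two suprema is the supremum over the disjoint union of the
    index sets ([isometric_prod_powers_prod]).  The theorem is thereby reduced
    to a fact about cardinals: a nonempty type [T] is infinite iff
    [T + T] and [T] are equipotent.

    If [X] is isometric to [X * X], the doubled decomposition is a second
    decomposition of [X] into the same primes.  Multiplicity uniqueness matches
    the two; as the primes are pairwise nonisometric, it matches each [P a] with
    itself, so [k a] and [k a + k a] are equipotent and [k a] is infinite
    ([infinite_of_inj_sum]).  Conversely, if every [k a] is infinite, then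
    [k a + k a] and [k a] are equipotent ([infinite_card_sum], which rests on
    Zorn's lemma).  Reindexing the coordinates turns the decomposition of [X * X]
    into that of [X], and two spaces isometric to the same product are isometric
    to each other. *)

Local Open Scope classical_set_scope.
Local Open Scope ring_scope.
Local Open Scope card_scope.
Import Order.TTheory.

Lemma card_leT_inj {T U : Type} (f : T -> U) :
  injective f -> [set: T] #<= [set: U].
Proof.
move=> f_inj; have /card_eqPle[_ le_im] : f @` [set: T] #= [set: T].
  by apply: inj_card_eq => x y _ _; exact: f_inj.
exact: card_le_trans le_im (card_leT _).
Qed.

(** [#=] speaks of the subtypes attached to two sets; for full sets these can be
    replaced by the types themselves, which is the form in which exponents are
    reindexed. *)
Lemma card_eqT_bijP {T U : Type} :
  [set: T] #= [set: U] <-> exists f : T -> U, bijective f.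
Proof.
have to_bij V : bijective (@to_setT V).
  by exists val => [//|x]; apply: val_inj.
have val_bij V : bijective (val : [set: V] -> V).
  by exists (@to_setT V) => [x|//]; apply: val_inj.
split=> [/card_bijP[f f_bij]|[f f_bij]].
  by exists (val \o f \o @to_setT T); apply: bij_comp => //; apply: bij_comp.
apply/card_bijP; exists (@to_setT U \o f \o val).
by apply: bij_comp => //; apply: bij_comp.
Qed.

(** Such a [g] makes [T] Dedekind infinite: [g \o inl] is an injection of [T] into
    itself that misses [g (inr t)], so its iterates on that point are distinct. *)
Lemma infinite_of_inj_sum (T : Type) (g : T + T -> T) :
  [set: T] !=set0 -> injective g -> infinite_set [set: T].
Proof.
move=> [t _] g_inj; apply/infiniteP.
pose h n := iter n (g \o inl) (g (inr t)).
apply: (@card_leT_inj _ _ h).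
by elim=> [|m IHm] [|n] //= /g_inj // [/IHm ->].
Qed.

(** The case [f = g] makes each sequence of the family injective.  Keeping
    this condition together with the disjointness of the ranges makes the whole
    property one about pairs of members, hence stable under unions of chains. *)
Definition disjoint_sequences {T : Type} (F : set (nat -> T)) : Prop :=
  forall f g m n, F f -> F g -> f m = g n -> f = g /\ m = n.

(** A disjoint family that is maximal under inclusion will do: an infinite
    remainder would contain the range of one more injective sequence. *)
Lemma disjoint_sequences_cofinite (T : Type) :
  exists2 F : set (nat -> T), disjoint_sequences F &
    finite_set (~` [set x | exists2 f, F f & range f x]).
Proof.
have chainP (C : set (set (nat -> T))) :
    C `<=` disjoint_sequences -> total_on C subset ->
    disjoint_sequences (\bigcup_(F in C) F).
  move=> C_disj C_tot f g m n [F CF Ff] [G CG Gg].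
  have [FG|GF] := C_tot _ _ CF CG.
    by apply: (C_disj _ CG) => //; exact: FG.
  by apply: (C_disj _ CF) => //; exact: GF.
have [F [F_disj F_max]] := Zorn_bigcup chainP.
exists F => //; set C := ~` _.
apply: contrapT => C_inf.
have [u u_inj Cu] : exists2 u : nat -> T, injective u & forall n, C (u n).
  have /card_leP[u] := (infiniteP C).1 C_inf.
  exists (val \o u \o @to_setT nat) => [m n /= /val_inj|n].
    by move=> /(inj (mem_setT _) (mem_setT _)) /(congr1 val).
  exact: set_valP.
apply: (F_max (F `|` [set u])).
  split=> [f Ff|sub]; first by left.
  by apply: (Cu 0%N); exists u; [apply: sub; right|exists 0%N].
move=> f g m n [Ff|->] [Gg|->] fg.
- exact: F_disj.
- by case: (Cu n); exists f => //; exists m.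
- by case: (Cu m); exists g => //; exists n.
- by split=> //; exact: u_inj.
Qed.

(** By Cantor-Bernstein only an injection of [T + T] into [T] is needed.  Let [F] be
    a disjoint family of sequences covering [T] up to a finite set [C]; it has a
    member [f0] since [T] is infinite.  A point of [T] is determined by a member of
    [F] and a countable label, the points outside the ranges being assigned to
    [f0].  Adding the side of the sum to the label keeps it countable, so the
    enriched label can serve as an index in the chosen sequence; disjointness of
    the family recovers the sequence and the label from the value. *)
Lemma infinite_card_sum (T : Type) :
  infinite_set [set: T] -> [set: T + T] #= [set: T].
Proof.
move=> T_inf; apply/card_eqPle; split; last first.
  by apply: (@card_leT_inj _ _ inl) => x y [].
have [F F_disj] := @disjoint_sequences_cofinite T.
set C := ~` _ => C_fin.
have [f0 Ff0] : exists f, F f.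
  apply: contra_notP T_inf => F0; apply: sub_finite_set C_fin => x _ [f Ff _].
  by apply: F0; exists f.
have /countable_injP[c c_inj] := finite_set_countable C_fin.
(* [inl n] labels the [n]-th term of a sequence of [F], [inr n] the point of [C]
   with number [n]; the tag separates the two uses of [f0]. *)
pose codes x (p : (nat -> T) * (nat + nat)) := F p.1 /\
  match p.2 with inl n => p.1 n = x | inr n => [/\ p.1 = f0, C x & c x = n] end.
have codeP x : exists p, codes x p.
  have [[f Ff [n _ fn]]|Cx] := pselect (exists2 f, F f & range f x).
    by exists (f, inl n).
  by exists (f0, inr (c x)).
have code_inj x y p : codes x p -> codes y p -> x = y.
  case: p => f [n|n] [/= Ff +] [_ +]; first by move=> <- <-.
  by move=> [_ Cx <-] [_ Cy /esym]; apply: c_inj; rewrite inE.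
have [code codesP] := choice codeP.
pose untag (s : T + T) := match s with inl x => x | inr x => x end.
pose side (s : T + T) := if s is inl _ then true else false.
pose g s := (code (untag s)).1 (pickle ((code (untag s)).2, side s)).
apply: (@card_leT_inj _ _ g) => s t gst.
have [eq1 /(pcan_inj pickleK) [eq2 eqb]] :=
  F_disj _ _ _ _ (codesP _).1 (codesP _).1 gst.
have eq_untag : untag s = untag t.
  apply: (code_inj _ _ _ (codesP _)).
  by rewrite [code (untag s)]surjective_pairing eq1 eq2 -surjective_pairing.
by case: s t eqb eq_untag {gst eq1 eq2} => x [] y //= _ ->.
Qed.

Section product_powers.
Context {R : realType}.

(** Suprema are compared below through their upper bounds only, which avoids any
    exchange of nested suprema and any case distinction on empty index types. *)
Lemma eq_from_le (u v : \bar R) :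
  (forall e, (u <= e)%E <-> (v <= e)%E) -> u = v.
Proof. by move=> uv; apply/le_anti; rewrite (uv v).2 ?(uv u).1. Qed.

Lemma sup_dist_le (I : Type) (T : I -> Type)
    (d : forall i, T i -> T i -> \bar R) (x y : forall i, T i) (e : \bar R) :
  (sup_dist d x y <= e)%E <->
  (0 <= e)%E /\ forall i, (d i (x i) (y i) <= e)%E.
Proof.
split=> [le_e|[e_ge0 le_e]].
  split=> [|i]; apply: le_trans le_e; apply: ereal_sup_ubound.
    by left.
  by right; exists i.
by apply: ge_ereal_sup => _ [->//|[i _ <-]].
Qed.

Lemma sup_power_dist_le (A : Type) (P : A -> metricType R) (k : A -> Type)
    (x y : forall a, k a -> P a) (e : \bar R) :
  (sup_dist (fun a => @power_dist R (P a) (k a)) x y <= e)%E <->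
  (0 <= e)%E /\ forall a i, ((mdist (x a i) (y a i))%:E <= e)%E.
Proof.
split=> [/sup_dist_le[e_ge0 le_e]|[e_ge0 le_e]].
  by split=> // a i; have := le_e a; rewrite /power_dist => /sup_dist_le[_]; apply.
by apply/sup_dist_le; split=> // a; rewrite /power_dist; apply/sup_dist_le.
Qed.

(** The condition [0 <= e] is what remains of the convention that an empty product
    has distance [0]: it cannot be dropped when no coordinate exists. *)
Lemma isometric_prod_powersP (X : metricType R) (A : Type)
    (P : A -> metricType R) (k : A -> Type) :
  isometric_prod_powers X P k <->
  exists2 f : X -> forall a, k a -> P a, bijective f &
    forall x y e, ((mdist x y)%:E <= e)%E <->
      (0 <= e)%E /\ forall a i, ((mdist (f x a i) (f y a i))%:E <= e)%E.
Proof.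
split=> -[f f_bij f_iso]; exists f => // x y.
  by move=> e; rewrite -f_iso; exact: sup_power_dist_le.
apply: eq_from_le => e; rewrite f_iso; exact: sup_power_dist_le.
Qed.

Lemma isometric_prod_powers_trans (X Y : metricType R) (A : Type)
    (P : A -> metricType R) (k : A -> Type) :
  isometric X Y -> isometric_prod_powers Y P k -> isometric_prod_powers X P k.
Proof.
move=> [f f_bij f_iso] [g g_bij g_iso]; exists (g \o f); first exact: bij_comp.
by move=> x y; rewrite /= g_iso f_iso.
Qed.

Lemma isometric_of_prod_powers (X Y : metricType R) (A : Type)
    (P : A -> metricType R) (k : A -> Type) :
  isometric_prod_powers X P k -> isometric_prod_powers Y P k -> isometric X Y.
Proof.
move=> [f f_bij f_iso] [g [g' gK g'K] g_iso]; exists (g' \o f).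
  by apply: bij_comp f_bij; exists g.
by move=> x y; apply: EFin_inj; rewrite -g_iso -f_iso /= !g'K.
Qed.

(** A supremum is unchanged when its indices are renamed, so only the cardinal of
    each exponent matters. *)
Lemma isometric_prod_powers_reindex (X : metricType R) (A : Type)
    (P : A -> metricType R) (k l : A -> Type) :
  (forall a, [set: l a] #= [set: k a]) ->
  isometric_prod_powers X P k -> isometric_prod_powers X P l.
Proof.
move=> lk /isometric_prod_powersP[f f_bij f_iso]; apply/isometric_prod_powersP.
have h a : {h : l a -> k a & {h' : k a -> l a | cancel h h' & cancel h' h}}.
  have [h h_bij] := cid (card_eqT_bijP.1 (lk a)); exists h.
  have [h' [hK h'K]] : {h' | cancel h h' /\ cancel h' h}.
    by apply: cid; case: h_bij => h' hK h'K; exists h'.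
  by exists h'.
pose r a := projT1 (h a); pose r' a := s2val (projT2 (h a)).
have rK a : cancel (r a) (r' a) := s2valP (projT2 (h a)).
have r'K a : cancel (r' a) (r a) := s2valP' (projT2 (h a)).
exists (fun x a j => f x a (r a j)).
  apply: (@bij_comp _ _ _ (fun (p : forall a, k a -> P a) a j => p a (r a j))) f_bij.
  exists (fun p a i => p a (r' a i)) => p.
    by apply: functional_extensionality_dep => a; apply/funext => i; rewrite r'K.
  by apply: functional_extensionality_dep => a; apply/funext => i; rewrite rK.
move=> x y e; rewrite f_iso; split=> -[e_ge0 le_e]; split=> // a i.
by rewrite -[i]r'K.
Qed.

Lemma isometric_prod_powers_prod (X Y : metricType R) (A : Type)
    (P : A -> metricType R) (k l : A -> Type) :
  isometric_prod_powers X P k -> isometric_prod_powers Y P l ->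
  isometric_prod_powers (X * Y)%type P (fun a => (k a + l a)%type).
Proof.
move=> /isometric_prod_powersP[f [f' fK f'K] f_iso].
move=> /isometric_prod_powersP[g [g' gK g'K] g_iso].
apply/isometric_prod_powersP.
exists (fun p a i =>
  match i with inl j => f p.1 a j | inr j => g p.2 a j end).
  exists (fun p => (f' (fun a j => p a (inl j)), g' (fun a j => p a (inr j)))).
    move=> [x y] /=; congr pair; first exact: fK.
    exact: gK.
  move=> p; apply: functional_extensionality_dep => a; apply/funext => -[j|j] /=.
    by rewrite f'K.
  by rewrite g'K.
move=> p q e.
have -> : mdist p q = Num.max (mdist p.1 q.1) (mdist p.2 q.2) by [].
rewrite EFin_max ge_max; split=> [/andP[/f_iso[e_ge0 le1] /g_iso[_ le2]]|].
  by split=> // a [j|j].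
move=> [e_ge0 le_e]; apply/andP; split.
  by apply/f_iso; split=> // a j; exact: (le_e a (inl j)).
by apply/g_iso; split=> // a j; exact: (le_e a (inr j)).
Qed.

End product_powers.

Theorem theorem1p5 (R : realType) (X : metricType R) (A : finType)
    (P : A -> metricType R) (k : A -> Type) :
  [set: X] !=set0 ->
  finite_set (distance_set X) ->
  (exists2 r, distance_set X r &
     rel_connected (threshold X r) /\ rel_separating (threshold X r)) ->
  prime_power_decomposition X P k ->
  (forall a, finite_set [set: P a]) ->
  cardinal_multiplicity_uniqueness X ->
  isometric X (X * X)%type <-> forall a, infinite_set [set: k a].
Proof.
move=> _ _ _ decX _ uniqX; have [isoX P_noniso P_prime k_neq0] := decX.
have isoXX := isometric_prod_powers_prod _ _ _ _ _ _ isoX isoX.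
split=> [X_XX a|k_inf].
  have decXX : prime_power_decomposition X P (fun a => (k a + k a)%type).
    split=> //; first exact: isometric_prod_powers_trans X_XX isoXX.
    by move=> b; have [i _] := k_neq0 b; exists (inl i).
  have [s _ sP] := uniqX _ _ _ _ _ _ decX decXX.
  have [P_sa] := sP a.
  have <- : a = s a by apply: contrapT => /P_noniso; apply.
  rewrite card_eq_sym => /card_eqT_bijP[g /bij_inj g_inj].
  exact: infinite_of_inj_sum g_inj.
apply: isometric_of_prod_powers isoX _.
apply: isometric_prod_powers_reindex isoXX => a.
by rewrite card_eq_sym; exact: infinite_card_sum.
Qed.
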